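(* Up to isomorphism there are exactly six central groupoids of order $9$: the natural central groupoid of order $9$ and five others, which are not isomorphic to the natural one.
   Context: A central groupoid is a set $S$ with a binary operation $\bullet$ satisfying $(a\bullet b)\bullet(b\bullet c)=b$ for all $a,b,c\in S$; its order is $|S|$. Isomorphism means a bijection preserving the operation. The natural central groupoid of order $n^2$ is $S=A\times A$ with $|A|=n$ and operation $(a,b)\bullet(c,d)=(b,c)$. (Central groupoids on $S$ correspond to directed graphs, loops allowed, on vertex set $S$ having exactly one directed path of length two from $a$ to $b$ for every ordered pair $(a,b)$ of vertices; $a\bullet b$ is the midpoint of that path.) *)

(* Defs.v *)
From mathcomp Require Import all_boot.

Set Implicit Arguments.
Unset Strict Implicit.
Unset Printing Implicit Defensive.

Definition central_groupoid (S : Type) (op : S -> S -> S) : Prop :=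
  forall a b c : S, op (op a b) (op b c) = b.

Definition groupoid_iso (S T : Type) (opS : S -> S -> S) (opT : T -> T -> T) :
    Prop :=
  exists f : S -> T,
    bijective f /\ (forall a b : S, f (opS a b) = opT (f a) (f b)).

Definition natural_op (A : Type) (p q : A * A) : A * A := (p.2, q.1).

(* Main.v *)
Require Import Defs.
From mathcomp Require Import all_boot.

(** Write [x -> y] when [y] is of the form [x * z].  If [e * e = e], then the
    successors [u] of [e] satisfy [e * u = e], and
    [(u, w) |-> u * (w * e)] is a bijection from pairs of successors onto the
    groupoid; so there are three successors [u_0 = e, u_1, u_2] when the order
    is 9.  In these coordinates each [(i, j)] has exactly one successor
    [(h i j k, k)] for every [k], where [h 0 j k = h i j 0 = j] and [h i _ k] is
    a permutation of {0, 1, 2}.  Hence the groupoid is determined by the four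
    permutations [h i _ k] with [i, k] in {1, 2}, and the 1296 candidates are
    sorted out by computation.  An idempotent [e] exists because [x |-> x * x]
    is an involution on a set of odd cardinality.  The six classes are told apart
    by the number of pairs with [y * (y * x) = x * (x * (x * x))], and the
    natural one by the law [x * (y * x) = x * (y * y)]. *)

Set Implicit Arguments.
Unset Strict Implicit.
Unset Printing Implicit Defensive.

(** * Isomorphism and isomorphism invariants *)

Lemma groupoid_iso_sym (S T : Type) (opS : S -> S -> S) (opT : T -> T -> T) :
  groupoid_iso opS opT -> groupoid_iso opT opS.
Proof.
move=> [f [[g gf fg] fM]]; exists g; split; first by exists f.
by move=> a b; rewrite -{1}(fg a) -{1}(fg b) -fM gf.
Qed.

Lemma groupoid_iso_trans (S T U : Type) (opS : S -> S -> S) (opT : T -> T -> T)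
    (opU : U -> U -> U) :
  groupoid_iso opS opT -> groupoid_iso opT opU -> groupoid_iso opS opU.
Proof.
move=> [f [bf fM]] [g [bg gM]]; exists (g \o f); split; first exact: bij_comp.
by move=> a b /=; rewrite fM gM.
Qed.

Definition signature (S : finType) (op : S -> S -> S) : nat :=
  \sum_(x : S) \sum_(y : S) (op y (op y x) == op x (op x (op x x))).

Lemma signature_iso (S T : finType) (opS : S -> S -> S) (opT : T -> T -> T) :
  groupoid_iso opS opT -> signature opS = signature opT.
Proof.
move=> [f [bf fM]]; rewrite /signature.
rewrite [RHS](reindex f) /=; last exact: onW_bij.
apply: eq_bigr => x _; rewrite [RHS](reindex f) /=; last exact: onW_bij.
by apply: eq_bigr => y _; rewrite -!fM (inj_eq (bij_inj bf)).
Qed.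

Definition left_flat (S : Type) (op : S -> S -> S) : Prop :=
  forall x y : S, op x (op y x) = op x (op y y).

Lemma left_flat_iso (S T : Type) (opS : S -> S -> S) (opT : T -> T -> T) :
  groupoid_iso opS opT -> left_flat opS -> left_flat opT.
Proof.
move=> /groupoid_iso_sym[f [bf fM]] flat x y.
by apply: (bij_inj bf); rewrite !fM flat.
Qed.

Lemma left_flat_natural (A : Type) : left_flat (@natural_op A).
Proof. by []. Qed.

(** Without a fixed point, [f] exchanges the set [A] of points ranked below their image with its
    complement, so [#|T|] would be even. *)
Lemma involution_fixpoint (T : finType) (f : T -> T) :
  involutive f -> odd #|T| -> exists x, f x = x.
Proof.
move=> fK oddT; have [/existsP[x /eqP]|] := boolP [exists x, f x == x].
  by exists x.
rewrite negb_exists => /forallP nofix.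
pose A := [set x | enum_rank x < enum_rank (f x)].
have fA : f @: A = ~: A.
  apply/setP => x; rewrite -{1}(fK x) (mem_imset _ _ (can_inj fK)) !inE fK.
  have : enum_rank (f x) != enum_rank x :> nat.
    by rewrite val_eqE (inj_eq enum_rank_inj).
  by case: ltngtP.
have := cardsC A; rewrite -fA card_imset; last exact: can_inj fK.
by move=> cardT; move: oddT; rewrite -cardT addnn odd_double.
Qed.

(** * Groupoids given by four permutations of {0, 1, 2} *)

(* [(i, j)] is encoded as [3 * i + j], and [P] lists the permutations
   [h 1 _ 1], [h 1 _ 2], [h 2 _ 1], [h 2 _ 2]. *)
Definition branch (P : seq (seq nat)) (i j k : nat) : nat :=
  if (i == 0) || (k == 0) then j
  else nth 0 (nth [::] P (2 * i.-1 + k.-1)) j.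

(** The label [m] is searched so that the successor [(h m, m)] of [x] has [y] as its own successor.
    If no label fits, [find] returns 3 and the value is meaningless. *)
Definition midpoint (P : seq (seq nat)) (x y : nat) : nat :=
  let h := branch P (x %/ 3) (x %% 3) in
  let m := find (fun m => branch P (h m) m (y %% 3) == y %/ 3) (iota 0 3) in
  3 * h m + m.

(** Two steps with labels [m], [l] lead from [(i, j)] to a vertex with second coordinate [l].
    Distinct first coordinates for each [l] make the nine paths end at nine different vertices. *)
Definition unique_midpoints (P : seq (seq nat)) : bool :=
  all (fun i => all (fun j => all (fun l =>
    uniq [seq branch P (branch P i j m) m l | m <- iota 0 3])
  (iota 0 3)) (iota 0 3)) (iota 0 3).

Definition codes : seq (seq (seq nat)) :=
  let perms := permutations (iota 0 3) in
  let pairs := [seq [:: p; q] | p <- perms, q <- perms] in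
  [seq pq ++ rs | pq <- pairs, rs <- pairs].

(** With four identities the successors of [(i, j)] are the [(j, k)], so the first entry is the
    natural groupoid. *)
Definition representatives : seq (seq (seq nat)) :=
  let id3 := [:: 0; 1; 2] in
  let s01 := [:: 1; 0; 2] in
  let s02 := [:: 2; 1; 0] in
  [:: [:: id3; id3; id3; id3];
      [:: id3; id3; id3; s01];
      [:: id3; s01; id3; id3];
      [:: id3; id3; s01; id3];
      [:: id3; s02; s01; id3];
      [:: id3; s01; s02; id3]].

Definition op9 (P : seq (seq nat)) (x y : 'I_9) : 'I_9 :=
  inord (midpoint P x y).

Definition closed9 (P : seq (seq nat)) : bool :=
  all (fun x => all (fun y => midpoint P x y < 9) (iota 0 9)) (iota 0 9).

Lemma all_iotaP (n : nat) (p : pred nat) :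
  reflect (forall x, x < n -> p x) (all p (iota 0 n)).
Proof.
apply: (iffP allP) => H x; last by rewrite mem_iota => /H.
by move=> xn; apply: H; rewrite mem_iota.
Qed.

Lemma val_op9 (P : seq (seq nat)) (x y : 'I_9) :
  closed9 P -> op9 P x y = midpoint P x y :> nat.
Proof.
move=> /all_iotaP/(_ x (ltn_ord x))/all_iotaP/(_ y (ltn_ord y)).
exact: inordK.
Qed.

Definition signature9 (P : seq (seq nat)) : nat :=
  let t := midpoint P in
  sumn [seq sumn [seq (t y (t y x) == t x (t x (t x x)) : nat) | y <- iota 0 9]
       | x <- iota 0 9].

Lemma signature_op9 (P : seq (seq nat)) :
  closed9 P -> signature (op9 P) = signature9 P.
Proof.
move=> cP; rewrite /signature /signature9 sumnE big_map -/(index_iota 0 9).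
rewrite big_mkord; apply: eq_bigr => x _.
rewrite sumnE big_map -/(index_iota 0 9) big_mkord; apply: eq_bigr => y _.
by rewrite -val_eqE /= !val_op9.
Qed.

Definition iso_witness (P Q : seq (seq nat)) (g : seq nat) : bool :=
  [&& size g == 9, uniq g, all (gtn 9) g &
   all (fun x => all (fun y =>
     nth 0 g (midpoint P x y) == midpoint Q (nth 0 g x) (nth 0 g y))
   (iota 0 9)) (iota 0 9)].

Lemma iso_witnessP (P Q : seq (seq nat)) (g : seq nat) :
  closed9 P -> closed9 Q -> iso_witness P Q g ->
  groupoid_iso (op9 P) (op9 Q).
Proof.
move=> cP cQ /and4P[/eqP sg ug /allP g9 /all_iotaP gM].
pose f (x : 'I_9) : 'I_9 := inord (nth 0 g x).
have fE x : f x = nth 0 g x :> nat.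
  by apply: inordK; apply: g9; rewrite mem_nth // sg.
exists f; split.
  apply: injF_bij => x y /(congr1 val); rewrite /= !fE => /eqP.
  by rewrite nth_uniq ?sg // => /eqP/val_inj.
move=> x y; apply: val_inj; rewrite /= fE !val_op9 // !fE.
by have /all_iotaP/(_ y (ltn_ord y))/eqP := gM x (ltn_ord x).
Qed.

(* The coordinate systems attached to the triples [e, u_1, u_2], among which a
   witness of isomorphism must occur. *)
Definition frames (P : seq (seq nat)) : seq (seq nat) :=
  let t := midpoint P in
  let frame u :=
    [seq t (nth 0 u (x %/ 3)) (t (nth 0 u (x %% 3)) (head 0 u)) | x <- iota 0 9]
  in
  flatten [seq let u := [seq x <- iota 0 9 | (t e x == e) && (x != e)] in
               [:: frame (e :: u); frame (e :: rev u)]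
          | e <- iota 0 9 & t e e == e].

Definition matches_representative (P : seq (seq nat)) : bool :=
  has (fun Q => has (iso_witness Q P) (frames P)) representatives.

Lemma codes_classified :
  all (fun P => closed9 P && matches_representative P)
    (filter unique_midpoints codes).
Proof. by vm_compute. Qed.

Lemma closed_representatives : all closed9 representatives.
Proof. by vm_compute. Qed.

(** * Coordinates around an idempotent *)

Section Coordinates.

Variables (S : finType) (op : S -> S -> S) (e : S) (us : seq S).
Hypothesis opC : central_groupoid op.
Hypothesis ee : op e e = e.
Hypothesis mem_us : forall x, (x \in us) = (op e x == e).
Hypothesis us_uniq : uniq us.
Hypothesis us_size : size us = 3.
Hypothesis us_head : nth e us 0 = e.

(** In arrows, [e -> u i -> g i j -> v j -> e]: the element [g i j] has coordinates [(i, j)], and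
    [c], [d] read them off. *)
Let u (i : nat) : S := nth e us i.
Let v (i : nat) : S := op (u i) e.
Let g (i j : nat) : S := op (u i) (v j).
Let c (x : S) : nat := index (op e x) us.
Let d (x : S) : nat := index (op e (op x e)) us.
Let h (i j k : nat) : nat := c (op (g i j) (v k)).

Let eeK x : op e (op e x) = e.
Proof. by rewrite -{1}ee opC. Qed.

Let eKe x : op (op x e) e = e.
Proof. by rewrite -{2}ee opC. Qed.

Let eu i : i < 3 -> op e (u i) = e.
Proof. by move=> i3; apply/eqP; rewrite -mem_us mem_nth ?us_size. Qed.

Let ev i : i < 3 -> op e (v i) = u i.
Proof. by move=> i3; rewrite /v -{1}(eu i3) opC. Qed.

Let eg i j : i < 3 -> op e (g i j) = u i.
Proof. by move=> i3; rewrite /g -{1}(eu i3) opC. Qed.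

Let ge i j : j < 3 -> op (g i j) e = v j.
Proof. by move=> j3; rewrite /g -{1}(eKe (u j)) opC. Qed.

Let u_c x : u (c x) = op e x.
Proof. by rewrite /u nth_index // mem_us eeK. Qed.

Let u_d x : u (d x) = op e (op x e).
Proof. by rewrite /u nth_index // mem_us eeK. Qed.

Let v_d x : v (d x) = op x e.
Proof. by rewrite /v u_d -{3}(eKe x) opC. Qed.

Let c3 x : c x < 3.
Proof. by rewrite -us_size index_mem mem_us eeK. Qed.

Let d3 x : d x < 3.
Proof. by rewrite -us_size index_mem mem_us eeK. Qed.

Let gK x : g (c x) (d x) = x.
Proof. by rewrite /g u_c v_d opC. Qed.

Let u_index i : i < 3 -> index (u i) us = i.
Proof. by move=> i3; rewrite index_uniq ?us_size. Qed.

Let c_g i j : i < 3 -> c (g i j) = i.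
Proof. by move=> i3; rewrite /c eg // u_index. Qed.

Let d_g i j : j < 3 -> d (g i j) = j.
Proof. by move=> j3; rewrite /d ge // ev // u_index. Qed.

Let h3 i j k : h i j k < 3.
Proof. exact: c3. Qed.

(** The product lies on a path from [g i j] to [v k]; as it precedes [v k], its second coordinate is
    [k]. *)
Let g_succ i j k : k < 3 -> op (g i j) (v k) = g (h i j k) k.
Proof.
move=> k3; rewrite -[LHS]gK; congr g; rewrite /d.
have -> : op (op (g i j) (v k)) e = v k by rewrite -{1}(eKe (u k)) opC.
by rewrite ev // u_index.
Qed.

Let v0 : v 0 = e.
Proof. by rewrite /v /u us_head. Qed.

(** Since [u 0 = e], the element [g 0 j] is [u j], whose successors are the [g j k]. *)
Let h0l j k : j < 3 -> h 0 j k = j.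
Proof.
move=> j3; rewrite /h /c /g {1}/u us_head ev //.
by rewrite -{1}(eu j3) opC u_index.
Qed.

Let h0r i j : j < 3 -> h i j 0 = j.
Proof. by move=> j3; rewrite /h v0 /c ge // ev // u_index. Qed.

(** The element [g i j] is recovered as the midpoint from [u i] to its successor with label [k]. *)
Let h_inj i j j' k : i < 3 -> j < 3 -> j' < 3 -> k < 3 ->
  h i j k = h i j' k -> j = j'.
Proof.
move=> i3 j3 j'3 k3 eqh.
have mid j1 : j1 < 3 -> op (u i) (g (h i j1 k) k) = g i j1.
  by move=> _; rewrite -g_succ // -{1}(eg j1 i3) opC.
by rewrite -(d_g i j3) -(d_g i j'3) -mid // eqh mid.
Qed.

Let g_midpoint i j m l : i < 3 -> j < 3 -> m < 3 -> l < 3 ->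
  op (g i j) (g (h (h i j m) m l) l) = g (h i j m) m.
Proof.
move=> i3 j3 m3 l3.
rewrite -[g (h (h i j m) m l) l]g_succ // -[g (h i j m) m]g_succ //.
(* The left factor [g i j] is rewritten as a product ending in [op (g i j) (v m)], which gives the
   shape of [opC]. *)
by rewrite -{1}(opC e (g i j) (v m)) opC.
Qed.

Let P : seq (seq nat) :=
  [seq [seq h p.1 j p.2 | j <- iota 0 3]
  | p <- [:: (1, 1); (1, 2); (2, 1); (2, 2)]].

Let branchP i j k : i < 3 -> j < 3 -> k < 3 -> branch P i j k = h i j k.
Proof.
case: i => [|[|[|//]]] _ j3; first by rewrite h0l.
  case: k => [|[|[|//]]] _; rewrite ?h0r //.
    by case: j j3 => [|[|[|//]]].
  by case: j j3 => [|[|[|//]]].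
case: k => [|[|[|//]]] _; rewrite ?h0r //.
  by case: j j3 => [|[|[|//]]].
by case: j j3 => [|[|[|//]]].
Qed.

(** Equal endpoints have equal midpoints, and the label is the second coordinate of the midpoint. *)
Let P_unique_midpoints : unique_midpoints P.
Proof.
apply/all_iotaP => i i3; apply/all_iotaP => j j3; apply/all_iotaP => l l3.
rewrite map_inj_in_uniq ?iota_uniq // => m m'; rewrite !mem_iota => m3 m'3.
rewrite !branchP // => eqh.
have := congr1 d (g_midpoint i3 j3 m3 l3).
by rewrite eqh g_midpoint // !d_g.
Qed.

Let P_codes : P \in codes.
Proof.
have perm i k : i < 3 -> k < 3 ->
    [seq h i j k | j <- iota 0 3] \in permutations (iota 0 3).
  move=> i3 k3; rewrite mem_permutations.
  have uq : uniq [seq h i j k | j <- iota 0 3].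
    rewrite map_inj_in_uniq ?iota_uniq // => j j'; rewrite !mem_iota => j3 j'3.
    exact: h_inj i3 j3 j'3 k3.
  apply: uniq_perm => //.
  by have [|//|] := uniq_min_size (s2 := iota 0 3) uq => // _ /mapP[j _ ->];
     rewrite mem_iota h3.
have pair i : i < 3 -> [:: [seq h i j 1 | j <- iota 0 3];
                           [seq h i j 2 | j <- iota 0 3]]
  \in [seq [:: p; q] | p <- permutations (iota 0 3),
                       q <- permutations (iota 0 3)].
  by move=> i3; apply: allpairs_f; apply: perm.
exact: (allpairs_f cat (pair 1 isT) (pair 2 isT)).
Qed.

Let G (x : 'I_9) : S := g (x %/ 3) (x %% 3).

Let midpoint_exists i j k l : i < 3 -> j < 3 -> k < 3 -> l < 3 ->
  exists2 m, m < 3 & h (h i j m) m l = k.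
Proof.
(* The label is read off the product [z] itself, which is the successor of [g i j] with label
   [d z]. *)
move=> i3 j3 k3 l3; pose z := op (g i j) (g k l); pose m := d z.
exists m; first exact: d3.
have zE : op (g i j) (v m) = z.
  by have := opC (op e (g i j)) z e; rewrite v_d {1}/z opC.
by rewrite /h -g_succ ?d3 // zE -(ge k l3) opC c_g.
Qed.

Let G_hom : closed9 P -> forall x y, G (op9 P x y) = op (G x) (G y).
Proof.
move=> cP x y; rewrite /G val_op9 // /midpoint.
have [x3 y3] : x %/ 3 < 3 /\ y %/ 3 < 3 by rewrite !ltn_divLR.
have [x3' y3'] : x %% 3 < 3 /\ y %% 3 < 3 by rewrite !ltn_mod.
move: (x %/ 3) (x %% 3) (y %/ 3) (y %% 3) x3 x3' y3 y3' => i j k l i3 j3 k3 l3.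
set p := fun m => _ == _; set m := find p _.
have hasp : has p (iota 0 3).
  have [n n3 hn] := midpoint_exists i3 j3 k3 l3; apply/hasP; exists n.
    by rewrite mem_iota.
  by rewrite /p !branchP // hn.
have m3 : m < 3 by rewrite /m -[X in _ < X](size_iota 0) -has_find.
have := nth_find 0 hasp; rewrite -/m nth_iota // /p !branchP // => /eqP <-.
rewrite g_midpoint //.
by rewrite mulnC divnMDl // modnMDl divn_small // modn_small // addn0.
Qed.

Let G_inj : injective G.
Proof.
move=> x y /[dup] /(congr1 c) eqc /(congr1 d) eqd; apply: val_inj => /=.
have lt3 (z : 'I_9) : z %/ 3 < 3 by rewrite ltn_divLR.
move: eqc eqd; rewrite /G !c_g ?d_g ?ltn_mod // => eqc eqd.
by rewrite (divn_eq x 3) (divn_eq y 3) eqc eqd.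
Qed.

Lemma coordinates_classified :
  #|S| = 9 -> exists2 Q, Q \in representatives & groupoid_iso op (op9 Q).
Proof.
move=> S9; have Pin : P \in filter unique_midpoints codes.
  by rewrite mem_filter P_unique_midpoints P_codes.
have /allP/(_ _ Pin)/andP[cP /hasP[Q Qin /hasP[w _ wP]]] := codes_classified.
(* The isomorphism is built backwards: [w] leads from [op9 Q] to [op9 P], and [G] from there to
   [S]. *)
exists Q => //; apply: groupoid_iso_sym.
apply: (groupoid_iso_trans (iso_witnessP _ cP wP)).
  by have /allP/(_ _ Qin) := closed_representatives.
exists G; split; last exact: G_hom.
by apply: inj_card_bij G_inj _; rewrite card_ord S9.
Qed.

End Coordinates.

(** * Idempotents, their successors, and the classification in order 9 *)

Lemma idempotent_exists (S : finType) (op : S -> S -> S) :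
  central_groupoid op -> odd #|S| -> exists e, op e e = e.
Proof. by move=> opC; apply: involution_fixpoint => x; apply: opC. Qed.

(** The map [F] is a bijection from [U x U] onto [S]: from [x = F (u, w)] one recovers [u = e * x]
    and [w = e * (x * e)]. *)
Lemma card_successors (S : finType) (op : S -> S -> S) (e : S) :
  central_groupoid op -> op e e = e -> #|S| = #|[set x | op e x == e]| ^ 2.
Proof.
move=> opC ee; set U := [set x | _]; pose F w := op w.1 (op w.2 e).
have eeK x : op e (op e x) = e by rewrite -{1}ee opC.
have eKe x : op (op x e) e = e by rewrite -{2}ee opC.
have ev u : u \in U -> op e (op u e) = u.
  by rewrite inE => /eqP eu; rewrite -{1}eu opC.
have eF u w : op e u = e -> op e (op u (op w e)) = u.
  by move=> eu; rewrite -{1}eu opC.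
have Fe u w : op (op u (op w e)) e = op w e by rewrite -{2}(eKe w) opC.
have F_inj : {in setX U U &, injective F}.
  move=> [u w] [u' w'] /setXP[Uu Uw] /setXP[Uu' Uw']; rewrite /F /= => eqF.
  move: Uu Uu'; rewrite !inE => /eqP eu /eqP eu'; congr (_, _).
    by rewrite -(eF u w eu) eqF eF.
  by rewrite -(ev w Uw) -(ev w' Uw') -(Fe u w) eqF Fe.
have F_surj : F @: setX U U = [set: S].
  apply/setP => x; rewrite in_setT; apply/imsetP.
  exists (op e x, op e (op x e)); first by rewrite !inE /= !eeK !eqxx.
  by rewrite /F /= -{4}(eKe x) !opC.
by rewrite -cardsT -F_surj card_in_imset // cardsX mulnn.
Qed.

Lemma central_groupoid9_classified (S : finType) (op : S -> S -> S) :
  #|S| = 9 -> central_groupoid op ->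
  exists2 P, P \in representatives & groupoid_iso op (op9 P).
Proof.
move=> S9 opC; have [e ee] : exists e, op e e = e.
  by apply: idempotent_exists; rewrite ?S9.
(* Listing [e] first makes [u_0 = e]. *)
pose U := [set x | op e x == e]; pose us := e :: enum (U :\ e).
have cardU : #|U| = 3.
  by apply/eqP; rewrite -(eqn_exp2r _ _ (isT : 0 < 2)) -card_successors ?S9.
have eU : e \in U by rewrite inE ee.
apply: (coordinates_classified opC ee (us := us)) => //.
- move=> x; rewrite inE mem_enum !inE; case: eqVneq => [->|//].
  by rewrite ee eqxx.
- by rewrite /= enum_uniq mem_enum !inE eqxx.
- by rewrite /= -cardE; have := cardsD1 e U; rewrite eU cardU => ->.
Qed.

(** * The six representatives and how they are told apart *)

Definition representative (i : 'I_6) : seq (seq nat) :=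
  nth [::] representatives i.

Lemma representative_closed i : closed9 (representative i).
Proof. by apply: (allP closed_representatives); apply: mem_nth. Qed.

Lemma representative_central i : central_groupoid (op9 (representative i)).
Proof.
have check : all (fun P => all (fun a => all (fun b => all (fun c =>
    midpoint P (midpoint P a b) (midpoint P b c) == b)
    (iota 0 9)) (iota 0 9)) (iota 0 9)) representatives.
  by vm_compute.
move=> a b c; apply: val_inj.
rewrite /= !(val_op9 _ _ (representative_closed i)).
have /allP/(_ _ (mem_nth [::] (ltn_ord i : i < size representatives))) := check.
move=> /all_iotaP/(_ _ (ltn_ord a))/all_iotaP/(_ _ (ltn_ord b)).
by move=> /all_iotaP/(_ _ (ltn_ord c))/eqP.
Qed.

Lemma representative_signature_inj :
  injective (fun i => signature (op9 (representative i))).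
Proof.
have ur : uniq (map signature9 representatives) by vm_compute.
have sigE i : signature (op9 (representative i)) =
    nth 0 (map signature9 representatives) i.
  by rewrite (nth_map [::] 0 signature9 (ltn_ord i : i < size representatives))
             (signature_op9 (representative_closed i)).
have lt6 (i : 'I_6) : i < size (map signature9 representatives).
  by rewrite size_map ltn_ord.
move=> i j; rewrite !sigE => /eqP; rewrite (nth_uniq 0 (lt6 i) (lt6 j) ur).
by move/eqP/val_inj.
Qed.

Lemma left_flat_representative i :
  left_flat (op9 (representative i)) -> i = ord0.
Proof.
have check : all (fun P => has (fun x => has (fun y =>
    midpoint P x (midpoint P y x) != midpoint P x (midpoint P y y))
    (iota 0 9)) (iota 0 9)) (behead representatives).
  by vm_compute.
case: (unliftP ord0 i) => [j ->|//] flat.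
have jP : representative (lift ord0 j) \in behead representatives.
  by rewrite /representative lift0 -nth_behead mem_nth // ltn_ord.
have /allP/(_ _ jP)/hasP[x x9 /hasP[y y9 /eqP[]]] := check.
rewrite !mem_iota in x9 y9.
have := congr1 val (flat (Ordinal x9) (Ordinal y9)).
by rewrite /= !(val_op9 _ _ (representative_closed _)).
Qed.

Theorem mainTheorem1 :
  exists F : 'I_6 -> 'I_9 -> 'I_9 -> 'I_9,
    [/\ forall i : 'I_6, central_groupoid (F i),
        forall i j : 'I_6, groupoid_iso (F i) (F j) -> i = j,
        forall (S : finType) (op : S -> S -> S),
          #|S| = 9 -> central_groupoid op ->
          exists i : 'I_6, groupoid_iso op (F i)
      & forall A : finType, #|A| = 3 ->
          forall i : 'I_6,
            groupoid_iso (F i) (@natural_op A) <-> i = ord0].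
Proof.
have classified (S : finType) (op : S -> S -> S) : #|S| = 9 ->
    central_groupoid op -> exists i, groupoid_iso op (op9 (representative i)).
  move=> S9 opC; have [P Pin opP] := central_groupoid9_classified S9 opC.
  have lti : index P representatives < 6 by rewrite index_mem.
  by exists (Ordinal lti); rewrite /representative nth_index.
exists (fun i => op9 (representative i)); split => //.
- exact: representative_central.
- by move=> i j /signature_iso; apply: representative_signature_inj.
move=> A A3 i; split=> [/groupoid_iso_sym iA | ->].
  exact/left_flat_representative/(left_flat_iso iA)/left_flat_natural.
have [||j jA] := classified (A * A)%type (@natural_op A).
- by rewrite card_prod A3.
- by case=> [a1 a2] [b1 b2] [c1 c2].
(* The classification matches the natural groupoid with some representative; its law [left_flat]
   forces that one to be the first. *)
have /left_flat_representative j0 := left_flat_iso jA (@left_flat_natural A).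
by rewrite -j0; apply: groupoid_iso_sym.
Qed.
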